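(* Let real numbers $s_{m,n}$, $m\in\{0,1\}$, $n\in\{0,1,2\}$, be given, and consider the truncated two-dimensional moment problem with $M=1$, $N=2$: find a non-negative measure $\mu$ on $\mathfrak{B}(\mathbb{R}^2)$ such that $\int_{\mathbb{R}^2} x_1^m x_2^n\, d\mu = s_{m,n}$ for all $m\in\{0,1\}$, $n\in\{0,1,2\}$. This moment problem has a solution if and only if one of the following conditions holds: (a) $s_{0,0}=s_{0,1}=s_{0,2}=s_{1,0}=s_{1,1}=s_{1,2}=0$; (b) $s_{0,0}>0$, and for some $\alpha\in\mathbb{R}$ one has $s_{m,n}=\alpha^n s_{m,0}$ for $m=0,1$ and $n=1,2$; (c) $s_{0,0}>0$ and $s_{0,0}s_{0,2}-s_{0,1}^2>0$. In case (a) the unique solution is $\mu\equiv 0$. In case (b), the truncated $K_0(\alpha)$-moment problem with moments $\{s_{m,n}\}_{m\in\{0,1\},\, n=0}$ is solvable, and a solution $\mu$ of the original moment problem can be obtained as a solution of this truncated $K_0(\alpha)$-moment problem. In case (c), for arbitrary $a_2>\sqrt{\frac{s_{0,2}}{s_{0,0}}}$, with $a_1=\frac{s_{0,1}}{s_{0,0}}$ and $a_0=-a_2$, the truncated $K_2(a_0,a_1,a_2)$-moment problem with the same data $\{s_{m,n}\}_{m\in\{0,1\},\,n\in\{0,1,2\}}$ is solvable, and a solution $\mu$ of the original moment problem can be obtained as a solution of this truncated $K_2(a_0,a_1,a_2)$-moment problem.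
   Context: $\mathfrak{B}(\mathbb{R}^2)$ denotes the Borel subsets of $\mathbb{R}^2$, and $x^0=1$ by convention. A solution of a moment problem is a non-negative Borel measure for which all the listed integrals exist (converge absolutely) and have the prescribed values. For real $a_0<a_1<\dots<a_N$, set $K_N(a_0,\dots,a_N)=\bigcup_{j=0}^N L_j$, where $L_j=\{(x_1,x_2)\in\mathbb{R}^2: x_2=a_j\}$; in particular $K_0(\alpha)=\{(x_1,x_2)\in\mathbb{R}^2: x_2=\alpha\}$. For a set $K\subseteq\mathbb{R}^2$, the truncated $K$-moment problem with data $\{s_{m,n}\}_{0\le m\le M,\,0\le n\le N}$ is: find a non-negative measure $\mu$ on $\mathfrak{B}(\mathbb{R}^2)$ with $\int_{\mathbb{R}^2}x_1^m x_2^n\,d\mu=s_{m,n}$ for all $0\le m\le M$, $0\le n\le N$, and $\mathrm{supp}\,\mu\subseteq K$. (For the $K_0(\alpha)$-problem in (b), only the moments with $n=0$ and $m=0,1$ are prescribed.) *)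

(* Defs.v *)
From HB Require Import structures.
From mathcomp Require Import all_boot all_order all_algebra.
From mathcomp Require Import all_classical all_reals all_analysis.
Import Order.TTheory GRing.Theory Num.Theory.
Import numFieldNormedType.Exports.

Set Implicit Arguments.
Unset Strict Implicit.
Unset Printing Implicit Defensive.

Local Open Scope classical_set_scope.
Local Open Scope ring_scope.

(* The plane equipped with its Borel sigma-algebra. The type is convertible to
   R * R, which carries the product topology. *)
Definition plane (R : realType) := g_sigma_algebraType (@open (R * R)%type).

Definition planeMeasure (R : realType) := {measure set (plane R) -> \bar R}.

(* Topological support: the complement of the union of all open null sets. *)
Definition supp (R : realType) (mu : planeMeasure R) : set (R * R) :=
  [set z | forall U : set (R * R), open U -> U z -> (0 < mu U)%E].

(* Only the values s m n with m <= M and n <= N are data of the problem. *)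
Definition moment_solution (R : realType) (M N : nat) (s : nat -> nat -> R)
    (mu : planeMeasure R) : Prop :=
  forall m n : nat, (m <= M)%N -> (n <= N)%N ->
    mu.-integrable setT (fun z : plane R => (z.1 ^+ m * z.2 ^+ n)%:E) /\
    (\int[mu]_(z in setT) (z.1 ^+ m * z.2 ^+ n)%:E)%E = (s m n)%:E.

Definition K_moment_solution (R : realType) (K : set (R * R)) (M N : nat)
    (s : nat -> nat -> R) (mu : planeMeasure R) : Prop :=
  moment_solution M N s mu /\ supp mu `<=` K.

(* The union of the horizontal lines at the heights listed in a. *)
Definition hlines (R : realType) (a : seq R) : set (R * R) :=
  \bigcup_(j in [set j | (j < size a)%N]) [set z | z.2 = a`_j].

Definition case_a (R : realType) (s : nat -> nat -> R) : Prop :=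
  forall m n : nat, (m <= 1)%N -> (n <= 2)%N -> s m n = 0.

Definition case_b (R : realType) (s : nat -> nat -> R) (alpha : R) : Prop :=
  0 < s 0%N 0%N /\
  forall m n : nat, (m <= 1)%N -> (1 <= n <= 2)%N ->
    s m n = alpha ^+ n * s m 0%N.

Definition case_c (R : realType) (s : nat -> nat -> R) : Prop :=
  0 < s 0%N 0%N /\ 0 < s 0%N 0%N * s 0%N 2%N - s 0%N 1%N ^+ 2.

(* Main.v *)
Require Import Defs.
From HB Require Import structures.
From mathcomp Require Import all_boot all_order all_algebra.
From mathcomp Require Import all_classical all_reals all_analysis.
From mathcomp Require Import measurable_realfun.
From mathcomp Require Import ring lra.
Import Order.TTheory GRing.Theory Num.Theory.
Import numFieldNormedType.Exports.

(** Necessity.  Let [mu] be a solution.  Its mass is [s 0 0].  If the mass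
    vanishes then so do all moments, which is case (a).  Otherwise put
    [alpha = s 0 1 / s 0 0], the mean height of [mu].  By [integral_sqr_dev],
    the integral of [(x2 - alpha)^2] is [(s 0 0 * s 0 2 - s 0 1 ^ 2) / s 0 0],
    hence this number is nonnegative.  If it is positive, case (c) holds; if
    it vanishes, [mu] is concentrated on the line [x2 = alpha]
    ([null_off_line]), where the factor [x2 ^ n] is the constant [alpha ^ n];
    this gives the relations of case (b) ([line_moments]).

    Sufficiency.  Solutions are finite sums of point masses, one on each of the
    prescribed lines.  In case (b) a single atom at [(s 1 0 / s 0 0, alpha)]
    suffices.  In case (c) there are three heights [a0], [a1], [a2], and
    Lagrange interpolation determines everything: a vector [t 0, t 1, t 2],
    seen as a linear functional on polynomials of degree at most 2, is the
    combination of the evaluations at the [a_j] whose weights are its values on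
    the Lagrange basis ([lagrange_weight_moments]).  The weights [W 0 j] of
    [s 0] are the masses of the atoms, and the weights [W 1 j] of [s 1] are the
    masses times the abscissas, so the j-th atom has abscissa [W 1 j / W 0 j].
    All that must be checked is that the masses are positive.  With [a0 = - a2]
    and [a1 = s 0 1 / s 0 0], the masses at [a0] and [a2] have numerator
    [s 0 2 - a1 * s 0 1], positive because [a1] is the mean height, and the
    mass at [a1] is [(a2 ^ 2 * s 0 0 - s 0 2) / (a2 ^ 2 - a1 ^ 2)], positive
    by the choice of [a2] ([case_c_heights]).

    In case (b), an arbitrary solution carried by the line must also be shown
    to solve the full problem.  The support of a measure is defined through
    open sets, so one needs that a closed set containing the support has null
    complement; this holds because the plane has a countable base of rational
    boxes ([supp_sub_null]).  The rest is [line_moments] again. *)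

Local Open Scope classical_set_scope.
Local Open Scope ring_scope.

Set Implicit Arguments.
Unset Strict Implicit.

(** * Finite sums of point masses *)

Section AtomicMeasure.
Context d (T : measurableType d) (R : realType).
Variables (k : nat) (w : nat -> {nonneg R}) (p : nat -> T).

Definition atomic_measure : {measure set T -> \bar R} :=
  msum (fun i => mscale (w i) (dirac (p i))) k.

Lemma atomic_measureE (A : set T) : atomic_measure A =
  (\sum_(i < k) (w i)%:num%:E * \d_(p i) A)%E.
Proof. by []. Qed.

Lemma ge0_integral_atomic (f : T -> \bar R) :
  measurable_fun setT f -> (forall z, (0 <= f z)%E) ->
  (\int[atomic_measure]_z f z = \sum_(i < k) (w i)%:num%:E * f (p i))%E.
Proof.
move=> mf f0; rewrite ge0_integral_measure_sum//.
apply: eq_bigr => i _; rewrite ge0_integral_mscale// integral_dirac//.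
by rewrite diracT mul1e.
Qed.

Lemma integral_atomic (f : T -> R) : measurable_fun setT f ->
  atomic_measure.-integrable setT (fun z => (f z)%:E) /\
  (\int[atomic_measure]_z (f z)%:E)%E =
    (\sum_(i < k) (w i)%:num * f (p i))%:E.
Proof.
move=> mf; have mEf : measurable_fun setT (fun z => (f z)%:E).
  exact/measurable_EFinP.
split.
  apply/integrableP; split => //.
  rewrite ge0_integral_atomic//; last exact: measurableT_comp.
  under eq_bigr do rewrite /= -EFinM.
  by rewrite sumEFin ltry.
rewrite integralE.
rewrite ge0_integral_atomic//; last exact: measurable_funepos.
rewrite ge0_integral_atomic//; last exact: measurable_funeneg.
have -> : (fun z => (f z)%:E) = EFin \o f by [].
rewrite funerpos funerneg.
under eq_bigr do rewrite /= -EFinM.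
under [X in (_ - X)%E]eq_bigr do rewrite /= -EFinM.
rewrite !sumEFin -EFinB -sumrB; congr (_%:E).
by apply: eq_bigr => i _; rewrite -mulrBr -[in RHS](funrposBneg f).
Qed.

End AtomicMeasure.

(** * Measurability and supports in the plane *)

Section Plane.
Context {R : realType}.
Implicit Types (mu : planeMeasure R) (K U : set (R * R)).

Lemma open_measurable_plane U : open U -> measurable (U : set (plane R)).
Proof. by move=> oU; apply: sub_sigma_algebra. Qed.

Lemma continuous_measurable_plane (f : R * R -> R) :
  continuous f -> measurable_fun setT (f : plane R -> R).
Proof.
move=> /continuousP cf.
apply: (measurability _ (RGenOpens.measurableE R)) => _ [_ [a [b ->] <-]].
rewrite setTI; apply: open_measurable_plane; exact/cf/interval_open.
Qed.

Lemma measurable_monomial (m n : nat) :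
  measurable_fun setT (fun z : plane R => z.1 ^+ m * z.2 ^+ n).
Proof.
apply: measurable_funM; apply: measurable_funX;
  apply: continuous_measurable_plane => z.
- exact: cvg_fst.
- exact: cvg_snd.
Qed.

Lemma measurable_monomialE (m n : nat) :
  measurable_fun setT (fun z : plane R => (z.1 ^+ m * z.2 ^+ n)%:E).
Proof. by apply/measurable_EFinP; exact: measurable_monomial. Qed.

Lemma closed_hlines (a : seq R) : closed (hlines a).
Proof.
apply: closed_bigcup; first exact: finite_II.
move=> j _; apply: (preimage_closed (f := snd) (D := [set x | x = a`_j])).
  by move=> z _; exact: cvg_snd.
exact: closed_eq.
Qed.

(** The rational open boxes form a countable base of the plane. *)
Definition rat_box (q : (rat * rat) * (rat * rat)) : set (R * R) :=
  `]ratr q.1.1, ratr q.1.2[ `*` `]ratr q.2.1, ratr q.2.2[.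

Lemma open_rat_box q : open (rat_box q).
Proof.
apply: openI.
- by apply: open_comp; [move=> z _; exact: cvg_fst|exact: interval_open].
- by apply: open_comp; [move=> z _; exact: cvg_snd|exact: interval_open].
Qed.

Lemma rat_box_nbhs U z : open U -> U z ->
  exists q, rat_box q z /\ rat_box q `<=` U.
Proof.
move=> oU Uz; have /nbhs_ballP[e /= e0 eU] : nbhs z U by exact: open_nbhs_nbhs.
have sub (x : R) : {q : rat * rat | ratr q.1 < x < ratr q.2 &
    forall y : R, ratr q.1 < y < ratr q.2 -> ball x e y}.
  have /rat_in_itvoo/cid[a] : x - e < x by rewrite ltrBlDr ltrDl.
  rewrite in_itv/= => /andP[xa ax].
  have /rat_in_itvoo/cid[b] : x < x + e by rewrite ltrDl.
  rewrite in_itv/= => /andP[xb bx].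
  exists (a, b) => /=; first by rewrite ax.
  move=> y /andP[ay yb]; rewrite /ball /= distrC ltr_distl.
  by rewrite (lt_trans xa)// (lt_trans yb).
have [q1 zq1 q1U] := sub z.1; have [q2 zq2 q2U] := sub z.2.
exists (q1, q2); split; first by split; rewrite /= in_itv.
move=> y [/=]; rewrite !in_itv/= => y1 y2; apply: eU.
by split; [exact: q1U|exact: q2U].
Qed.

(** Lindelof argument: each point off [K] lies in an open null set, hence in a
    null rational box, and there are only countably many such boxes. *)
Lemma supp_sub_null mu K : closed K -> supp mu `<=` K -> mu (~` K) = 0%E.
Proof.
move=> cK suppK; have oK : open (~` K) by exact: closed_openC.
apply: (measure_negligible (mu := mu)); first exact: open_measurable_plane.
(* [F] enumerates the null rational boxes, padded with empty sets. *)
pose F n := if unpickle n is Some q then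
  if mu (rat_box q) == 0%E then rat_box q else set0 else set0.
apply: (@negligibleS _ _ _ mu (\bigcup_n F n)); last first.
  apply: negligible_bigcup => n; rewrite /F.
  case: unpickle => [q|]; last exact: negligible_set0.
  case: eqP => [mq|_]; last exact: negligible_set0.
  by apply/negligibleP => //; apply: open_measurable_plane; exact: open_rat_box.
move=> z Kz; have : ~ supp mu z by move=> /suppK.
move=> /existsNP[U /not_implyP[oU /not_implyP[Uz /negP]]].
rewrite -leNgt measure_le0 => /eqP mU0.
have [q [zq qU]] := rat_box_nbhs oU Uz.
exists (pickle q); [exact: I|rewrite /F pickleK].
suff -> : mu (rat_box q) = 0%E by rewrite eqxx.
apply: (subset_measure0 _ _ _ mU0) => //; apply: open_measurable_plane => //.
exact: open_rat_box.
Qed.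

Lemma null_supp_sub mu K : closed K -> mu (~` K) = 0%E -> supp mu `<=` K.
Proof.
move=> cK mK z sz; apply: contrapT => Kz.
have := sz (~` K) (closed_openC cK) Kz.
by rewrite mK ltxx.
Qed.

End Plane.

(** * Basic facts on solutions *)

Section Solutions.
Context {R : realType}.
Implicit Types (mu : planeMeasure R) (s : nat -> nat -> R).

Lemma moment_solution_mass M N s mu :
  moment_solution M N s mu -> mu setT = (s 0%N 0%N)%:E.
Proof.
move=> /(_ 0%N 0%N isT isT)[_ <-].
rewrite -[LHS]mul1e -integral_cst//; apply: eq_integral => z _.
by rewrite !expr0 mulr1.
Qed.

Lemma null_moment_solutionP M N s mu : mu setT = 0%E ->
  moment_solution M N s mu <->
  (forall m n, (m <= M)%N -> (n <= N)%N -> s m n = 0).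
Proof.
move=> mu0.
have int0 m n : (\int[mu]_z (z.1 ^+ m * z.2 ^+ n)%:E)%E = 0%E.
  by apply: null_set_integral => //; exact: measurable_monomialE.
split=> [sol m n mM nN|s0 m n mM nN].
  by have [_] := sol m n mM nN; rewrite int0 => -[].
rewrite s0//; split; last exact: int0.
by apply: null_set_integrable => //; exact: measurable_monomialE.
Qed.

(** Reduces the existence of a solution to finding nonnegative weights and
    nodes on [K] that satisfy finitely many scalar equations. *)
Lemma atomic_solution M N k (w : nat -> {nonneg R}) (p : nat -> R * R)
    s (K : set (R * R)) :
  closed K -> (forall i, (i < k)%N -> K (p i)) ->
  (forall m n, (m <= M)%N -> (n <= N)%N ->
    \sum_(i < k) (w i)%:num * ((p i).1 ^+ m * (p i).2 ^+ n) = s m n) ->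
  K_moment_solution K M N s (atomic_measure k w (p : nat -> plane R)).
Proof.
move=> cK Kp sE; split.
  move=> m n mM nN.
  have [fi fE] := integral_atomic k w (p : nat -> plane R) (measurable_monomial m n).
  by split; [exact: fi|rewrite fE sE].
apply: null_supp_sub => //; rewrite atomic_measureE big1// => i _.
by rewrite diracE memNset ?mule0//=; apply; exact: Kp.
Qed.

(** On the line the monomial [x1 ^ m * x2 ^ n] is [alpha ^ n * x1 ^ m], and the
    complement of the line does not contribute.  This single fact serves both
    directions of case (b). *)
Lemma line_moments mu alpha m n (c : R) :
  mu (~` hlines [:: alpha]) = 0%E ->
  mu.-integrable setT (fun z : plane R => (z.1 ^+ m * z.2 ^+ 0)%:E) ->
  (\int[mu]_z (z.1 ^+ m * z.2 ^+ 0)%:E)%E = c%:E ->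
  mu.-integrable setT (fun z : plane R => (z.1 ^+ m * z.2 ^+ n)%:E) /\
  (\int[mu]_z (z.1 ^+ m * z.2 ^+ n)%:E)%E = (alpha ^+ n * c)%:E.
Proof.
move=> mu0 fi fE; pose D : set (plane R) := ~` hlines [:: alpha].
have mD : measurable D.
  by apply: open_measurable_plane; apply: closed_openC; exact: closed_hlines.
have fgi := integrableZl measurableT (alpha ^+ n) fi.
(* The factor [z.2 ^+ 0] is kept so that [fi] and [fE] apply as they stand. *)
have onK : {in setT `\` D, (fun z => (alpha ^+ n)%:E * (z.1 ^+ m * z.2 ^+ 0)%:E)%E
    =1 (fun z : plane R => (z.1 ^+ m * z.2 ^+ n)%:E)}.
  move=> z; rewrite inE => -[_ /contrapT[[|j]//= _ ->]].
  by rewrite expr0 mulr1 -EFinM mulrC.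
have gi : mu.-integrable setT (fun z : plane R => (z.1 ^+ m * z.2 ^+ n)%:E).
  apply/(negligible_integrable mD) => //; first exact: measurable_monomialE.
  apply: eq_integrable onK _; first exact: measurableD.
  apply: (iffLR (negligible_integrable mD _ _ mu0)) => //.
  exact: (measurable_int mu fgi).
split => //; rewrite (negligible_integral mD)// -(eq_integral _ _ onK).
by rewrite -(negligible_integral mD)// integralZl// fE.
Qed.

(** * Vanishing moments and the single line *)

Lemma moment_solution_case_a s : case_a s -> forall mu,
  moment_solution 1 2 s mu <-> (forall A : set (plane R), measurable A -> mu A = 0%E).
Proof.
move=> sa mu; split=> [sol A mA|mu0]; last first.
  by apply/null_moment_solutionP; [exact: mu0|exact: sa].
apply: (subset_measure0 mA measurableT) => //.
by apply: (etrans (moment_solution_mass sol)); rewrite sa.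
Qed.

Lemma line_solution_case_b s alpha mu : case_b s alpha ->
  K_moment_solution (hlines [:: alpha]) 1 0 s mu -> moment_solution 1 2 s mu.
Proof.
move=> [_ sb] [sol suppK] m n m1 n2.
have [fi fE] := sol m 0%N m1 isT.
(* This is where the hypothesis on the support becomes one on null sets. *)
have mu0 := supp_sub_null (@closed_hlines R _) suppK.
have [gi gE] := line_moments n mu0 fi fE.
split => //; rewrite gE; congr _%:E.
by case: n n2 {gi gE} => [|n] n2; [rewrite expr0 mul1r|rewrite -sb].
Qed.

Lemma line_solution_exists s alpha : 0 < s 0%N 0%N ->
  exists mu, K_moment_solution (hlines [:: alpha]) 1 0 s mu.
Proof.
move=> s0.
(* One atom of mass [s 0 0], with abscissa the mean of [x1]. *)
pose p (i : nat) := (s 1%N 0%N / s 0%N 0%N, alpha).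
exists (atomic_measure 1 (fun=> NngNum (ltW s0)) (p : nat -> plane R)).
apply: atomic_solution; first exact: closed_hlines.
  by move=> i _; exists 0%N.
move=> m [|//] m1 _; rewrite big_ord1/= expr0 mulr1.
case: m m1 => [|[|//]] _; first by rewrite expr0 mulr1.
by rewrite expr1 mulrCA divff ?mulr1// gt_eqF.
Qed.

(** * Three lines *)

(** The inequality [s 0 1 ^ 2 < s 0 0 * s 0 2] says that [a1 ^ 2] is less than
    the mean [s 0 2 / s 0 0] of the squared height, which is less than
    [a2 ^ 2]. *)
Lemma case_c_heights s (a2 : R) : case_c s ->
  Num.sqrt (s 0%N 2%N / s 0%N 0%N) < a2 ->
  - a2 < s 0%N 1%N / s 0%N 0%N < a2 /\ s 0%N 2%N < a2 ^+ 2 * s 0%N 0%N.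
Proof.
move=> [s0 D] a2s.
have a20 : 0 < a2 by apply: le_lt_trans a2s; exact: sqrtr_ge0.
have h : s 0%N 2%N / s 0%N 0%N < a2 ^+ 2.
  have s2 : 0 <= s 0%N 2%N / s 0%N 0%N.
    apply: divr_ge0 (ltW s0).
    have := sqr_ge0 (s 0%N 1%N) => h.
    by rewrite -(pmulr_rge0 _ s0); lra.
  by rewrite -(sqr_sqrtr s2) ltr_pXn2r// nnegrE ?sqrtr_ge0 ?ltW.
have h' : s 0%N 2%N < a2 ^+ 2 * s 0%N 0%N by rewrite -ltr_pdivrMr.
split => //; rewrite -ltr_norml -(@ltr_pXn2r _ 2)// ?nnegrE ?ltW// real_normK ?num_real//.
apply: le_lt_trans h; rewrite expr_div_n ler_pdivrMr ?exprn_gt0//.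
by rewrite expr2 mulrA divfK ?gt_eqF// mulrC; lra.
Qed.

(** The value of the functional [x2 ^ n |-> s m n] on the Lagrange polynomial
    [(X - b) (X - c) / ((a - b) (a - c))], which is 1 at [a] and vanishes at
    [b] and [c]. *)
Definition lagrange_weight s m (a b c : R) : R :=
  (s m 2%N - (b + c) * s m 1%N + b * c * s m 0%N) / ((a - b) * (a - c)).

(** Lagrange interpolation reproduces the polynomials [X ^ n] for [n <= 2];
    applying the functional to the interpolation identity gives this. *)
Lemma lagrange_weight_moments s m n (a b c : R) :
  a != b -> b != c -> c != a -> (n <= 2)%N ->
  lagrange_weight s m a b c * a ^+ n + lagrange_weight s m b c a * b ^+ n +
    lagrange_weight s m c a b * c ^+ n = s m n.
Proof.
move=> ab bc ca.
have sub0 (x y : R) : x != y -> x - y != 0 /\ y - x != 0.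
  by move=> xy; rewrite !subr_eq0 (eq_sym y) xy.
have [[ab0 ba0] [bc0 cb0] [ca0 ac0]] := And3 (sub0 _ _ ab) (sub0 _ _ bc) (sub0 _ _ ca).
rewrite /lagrange_weight.
by case: n => [|[|[|//]]] _; field; rewrite ?ab0 ?bc0 ?ca0 ?ba0 ?cb0 ?ac0.
Qed.

(** The Lagrange weights of [s 0] are the masses of the atoms; those of [s 1]
    are mass times abscissa. *)
Lemma three_lines_solution_exists s (a2 : R) : case_c s ->
  Num.sqrt (s 0%N 2%N / s 0%N 0%N) < a2 ->
  exists mu, K_moment_solution
    (hlines [:: - a2; s 0%N 1%N / s 0%N 0%N; a2]) 1 2 s mu.
Proof.
move=> sc a2s; have [/andP[a0a1 a1a2] s2a2] := case_c_heights sc a2s.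
have [s0 D] := sc; set a1 := _ / _ in a0a1 a1a2 *.
have s01 : s 0%N 1%N = a1 * s 0%N 0%N by rewrite divfK// gt_eqF.
have a20 : 0 < a2 by lra.
pose W m := lagrange_weight s m.
(* Up to the factor [s 0 0], this is the inequality of case (c). *)
have V0 : 0 < s 0%N 2%N - a1 * s 0%N 1%N.
  by rewrite -(pmulr_rgt0 _ s0) mulrBr mulrA (mulrC _ a1) -s01 -expr2.
have W0 : 0 < W 0%N (- a2) a1 a2.
  rewrite /W /lagrange_weight s01; rewrite s01 in V0.
  by apply: divr_gt0; [lra|nra].
have W1 : 0 < W 0%N a1 a2 (- a2).
  (* Numerator and denominator are both negative. *)
  rewrite /W /lagrange_weight -[X in 0 < X]opprK -mulNr -mulrN -invrN.
  by apply: divr_gt0; nra.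
have W2 : 0 < W 0%N a2 (- a2) a1.
  rewrite /W /lagrange_weight s01; rewrite s01 in V0.
  by apply: divr_gt0; [lra|nra].
pose w i := nth (NngNum (ltW W0))
  [:: NngNum (ltW W0); NngNum (ltW W1); NngNum (ltW W2)] i.
pose p i := nth (0, 0) [:: (W 1%N (- a2) a1 a2 / W 0%N (- a2) a1 a2, - a2);
  (W 1%N a1 a2 (- a2) / W 0%N a1 a2 (- a2), a1);
  (W 1%N a2 (- a2) a1 / W 0%N a2 (- a2) a1, a2)] i.
exists (atomic_measure 3 w (p : nat -> plane R)).
apply: atomic_solution; first exact: closed_hlines.
  by case=> [|[|[|//]]] _; [exists 0%N|exists 1%N|exists 2%N].
move=> m n m1 n2; rewrite !big_ord_recl big_ord0/= addr0 addrA.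
rewrite -(@lagrange_weight_moments s m n (- a2) a1 a2)//; last 3 first.
- by rewrite lt_eqF.
- by rewrite lt_eqF.
- by rewrite gt_eqF//; lra.
rewrite !mulrA.
case: m m1 => [|[|//]] _; first by rewrite !expr0 !mulr1.
(* Mass times abscissa is the weight of [s 1]. *)
have cancel (x y z : R) : 0 < x -> x * (y / x) * z = y * z.
  by move=> x0; rewrite mulrCA divff ?mulr1// gt_eqF.
by rewrite !expr1 !cancel.
Qed.

(** * Necessity of the conditions *)

Lemma integral_sqr_dev M s mu (alpha : R) : moment_solution M 2 s mu ->
  (\int[mu]_z ((z.2 - alpha) ^+ 2)%:E)%E =
  (s 0%N 2%N - 2 * alpha * s 0%N 1%N + alpha ^+ 2 * s 0%N 0%N)%:E.
Proof.
move=> sol.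
have [i0 e0] := sol 0%N 0%N isT isT.
have [i1 e1] := sol 0%N 1%N isT isT.
have [i2 e2] := sol 0%N 2%N isT isT.
have j1 := integrableZl measurableT (- (2 * alpha)) i1.
have j0 := integrableZl measurableT (alpha ^+ 2) i0.
transitivity (\int[mu]_z ((z.1 ^+ 0 * z.2 ^+ 2)%:E +
   ((- (2 * alpha))%:E * (z.1 ^+ 0 * z.2 ^+ 1)%:E) +
   ((alpha ^+ 2)%:E * (z.1 ^+ 0 * z.2 ^+ 0)%:E)))%E.
  by apply: eq_integral => z _; rewrite -!EFinM -!EFinD; congr _%:E; ring.
rewrite integralD//; last exact: integrableD.
rewrite integralD// !integralZl// e0 e1 e2 -!EFinM -!EFinD.
by congr _%:E; ring.
Qed.

(** A nonnegative function with zero integral vanishes almost everywhere. *)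
Lemma null_off_line mu (alpha : R) :
  (\int[mu]_z ((z.2 - alpha) ^+ 2)%:E)%E = 0%E ->
  mu (~` hlines [:: alpha]) = 0%E.
Proof.
move=> int0; have mq : measurable_fun setT (fun z : plane R => ((z.2 - alpha) ^+ 2)%:E).
  apply/measurable_EFinP; apply: measurable_funX; apply: measurable_funB => //.
  by apply: continuous_measurable_plane => z; exact: cvg_snd.
have : (\int[mu]_z `|((z.2 - alpha) ^+ 2)%:E|)%E = 0%E.
  by rewrite -int0; apply: eq_integral => z _; rewrite gee0_abs// lee_fin sqr_ge0.
move=> /(ae_eq_integral_abs mu measurableT mq)[N [mN N0 qN]].
apply: (subset_measure0 _ mN _ N0).
  by apply: open_measurable_plane; apply: closed_openC; exact: closed_hlines.
move=> z zK; apply: qN => /= /(_ I)[] /eqP; rewrite sqrf_eq0 subr_eq0 => /eqP za.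
by apply: zK; exists 0%N.
Qed.

Lemma moment_solution_cases s mu : moment_solution 1 2 s mu ->
  [\/ case_a s, exists alpha, case_b s alpha | case_c s].
Proof.
move=> sol; have mass := moment_solution_mass sol.
have : 0 <= s 0%N 0%N by rewrite -lee_fin -mass measure_ge0.
rewrite le_eqVlt => /predU1P[s0|s0].
  apply: Or31; apply/(null_moment_solutionP _ _ _ (mu := mu)) => //.
  by rewrite mass -s0.
pose alpha := s 0%N 1%N / s 0%N 0%N.
have intE := integral_sqr_dev alpha sol.
have E : s 0%N 2%N - 2 * alpha * s 0%N 1%N + alpha ^+ 2 * s 0%N 0%N =
    (s 0%N 0%N * s 0%N 2%N - s 0%N 1%N ^+ 2) / s 0%N 0%N.
  by rewrite /alpha; field; rewrite gt_eqF.
rewrite E in intE.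
have : 0 <= (s 0%N 0%N * s 0%N 2%N - s 0%N 1%N ^+ 2) / s 0%N 0%N.
  by rewrite -lee_fin -intE; apply: integral_ge0 => z _; rewrite lee_fin sqr_ge0.
rewrite le_eqVlt => /predU1P[D0|]; last first.
  by rewrite pmulr_lgt0 ?invr_gt0// => D; apply: Or33.
(* Zero variance of the height: [mu] lives on the line of mean height. *)
rewrite -D0 in intE; apply: Or32; exists alpha; split => // m n m1 /andP[_ n2].
have [fi fE] := sol m 0%N m1 isT.
have [_] := line_moments n (null_off_line intE) fi fE.
by have [_ ->] := sol m n m1 n2 => -[].
Qed.

End Solutions.

Unset Implicit Arguments.

Theorem theorem2 (R : realType) (s : nat -> nat -> R) :
  [/\ (exists mu : planeMeasure R, moment_solution 1 2 s mu) <->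
        [\/ case_a s, exists alpha : R, case_b s alpha | case_c s],
      case_a s -> forall mu : planeMeasure R,
        moment_solution 1 2 s mu <->
        (forall A : set (plane R), measurable A -> mu A = 0%E),
      forall alpha : R, case_b s alpha ->
        (exists mu : planeMeasure R,
           K_moment_solution (hlines [:: alpha]) 1 0 s mu) /\
        (forall mu : planeMeasure R,
           K_moment_solution (hlines [:: alpha]) 1 0 s mu ->
           moment_solution 1 2 s mu)
    & case_c s -> forall a2 : R, Num.sqrt (s 0%N 2%N / s 0%N 0%N) < a2 ->
        let a1 := s 0%N 1%N / s 0%N 0%N in
        let a0 := - a2 in
        [/\ a0 < a1 < a2,
            exists mu : planeMeasure R,
              K_moment_solution (hlines [:: a0; a1; a2]) 1 2 s mu
          & forall mu : planeMeasure R,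
              K_moment_solution (hlines [:: a0; a1; a2]) 1 2 s mu ->
              moment_solution 1 2 s mu]].
Proof.
(* Any height above the square root will do; take it plus one. *)
have solc : case_c s -> exists mu : planeMeasure R,
    K_moment_solution (hlines [:: - (1 + Num.sqrt (s 0%N 2%N / s 0%N 0%N));
      s 0%N 1%N / s 0%N 0%N; 1 + Num.sqrt (s 0%N 2%N / s 0%N 0%N)]) 1 2 s mu.
  by move=> sc; apply: three_lines_solution_exists => //; rewrite ltrDr.
split.
- split=> [[mu]|[sa|[alpha sb]|sc]]; first exact: moment_solution_cases.
  + by exists mzero; apply/moment_solution_case_a.
  + have [mu] := line_solution_exists alpha sb.1.
    by exists mu; apply: line_solution_case_b sb _.
  + by have [mu []] := solc sc; exists mu.
- exact: moment_solution_case_a.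
- move=> alpha sb; split; first exact: line_solution_exists sb.1.
  by move=> mu; exact: line_solution_case_b.
- move=> sc a2 a2s a1 a0; split.
  + by have [] := case_c_heights sc a2s.
  + exact: three_lines_solution_exists.
  + by move=> mu [].
Qed.
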